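(* For every integer $h\ge 1$, $L(\mathbf{URecMAJ}_3^h) = L_m(\mathbf{URecMAJ}_3^h) = 4h+1$.
   Context: $\mathbf{MAJ}_3$ is the 3-bit majority function (outputs $1$ iff at least two inputs are $1$). The unbalanced recursive ternary majority functions $\mathbf{URecMAJ}_3^h:\{0,1\}^{2h+1}\to\{0,1\}$ are defined by $\mathbf{URecMAJ}_3^1=\mathbf{MAJ}_3$ and, for $h\ge 2$, $\mathbf{URecMAJ}_3^h(x_1,\dots,x_{2h+1}) = \mathbf{MAJ}_3(\mathbf{URecMAJ}_3^{h-1}(x_1,\dots,x_{2h-1}), x_{2h}, x_{2h+1})$. A formula is a binary tree whose leaves are labeled by literals (variables or negated variables) and whose internal nodes are labeled by $\wedge$ or $\vee$; it is monotone if it has no negated variables; its size is its number of leaves. $L(f)$ (resp. $L_m(f)$) is the minimum size of a formula (resp. monotone formula) computing $f$. *)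

(* Defs.v *)
From mathcomp Require Import all_boot.

Set Implicit Arguments.
Unset Strict Implicit.
Unset Printing Implicit Defensive.

Definition boolfun (n : nat) : Type := n.-tuple bool -> bool.

Definition MAJ3 : boolfun 3 := fun x => 2 <= count_mem true x.

(* The informal variable x_i (1 <= i <= 2h+1) is the entry i.-1 of the tuple,
   and every index below is in range, so the default [false] of [nth] is never
   used.  The functions are meant for h >= 1 only; the value at 0 is arbitrary
   and is not used by the recursion. *)
Fixpoint URecMAJ3 (h : nat) : boolfun h.*2.+1 :=
  match h return boolfun h.*2.+1 with
  | 0 => fun x => thead x
  | h'.+1 =>
    match h' return boolfun h'.*2.+1 -> boolfun h'.+1.*2.+1 with
    | 0 => fun _ => MAJ3
    | k.+1 => fun rec x =>
        MAJ3 [tuple rec [tuple nth false x i | i < k.+1.*2.+1];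
                    nth false x k.+1.*2.+1;
                    nth false x k.+1.*2.+2]
    end (@URecMAJ3 h')
  end.
Arguments URecMAJ3 h x : clear implicits.

Inductive formula (n : nat) : Type :=
| Var of 'I_n
| NegVar of 'I_n
| And of formula n & formula n
| Or of formula n & formula n.

Fixpoint feval n (F : formula n) (x : n.-tuple bool) : bool :=
  match F with
  | Var i => tnth x i
  | NegVar i => ~~ tnth x i
  | And F1 F2 => feval F1 x && feval F2 x
  | Or F1 F2 => feval F1 x || feval F2 x
  end.

Fixpoint fsize n (F : formula n) : nat :=
  match F with
  | Var _ | NegVar _ => 1
  | And F1 F2 | Or F1 F2 => fsize F1 + fsize F2
  end.

Fixpoint monotone n (F : formula n) : bool :=
  match F with
  | Var _ => true
  | NegVar _ => false
  | And F1 F2 | Or F1 F2 => monotone F1 && monotone F2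
  end.

Definition computes n (F : formula n) (f : boolfun n) : Prop :=
  forall x, feval F x = f x.

Definition is_minimum (S : nat -> Prop) (m : nat) : Prop :=
  S m /\ forall k, S k -> m <= k.

(* [L_eq f m] is "L(f) = m" and [Lm_eq f m] is "L_m(f) = m".  They are relations
   because the minimum need not exist: a function that is not monotone has no
   monotone formula, and there are no formulas over 0 variables. *)
Definition L_eq n (f : boolfun n) (m : nat) : Prop :=
  is_minimum (fun s => exists F : formula n, computes F f /\ fsize F = s) m.

Definition Lm_eq n (f : boolfun n) (m : nat) : Prop :=
  is_minimum
    (fun s => exists F : formula n, [/\ monotone F, computes F f & fsize F = s])
    m.

(* Main.v *)
Require Import Defs.
From mathcomp Require Import all_boot.
From mathcomp Require Import zify.

(** Write [f] for the function of height [h] and [maj f x y] for the one of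
    height [h.+1].  A formula for [maj f x y] has at least four more leaves than
    some formula for [f]: fixing [x] and [y] to opposite values leaves [f], so it
    suffices to lose four leaves.  If [x] and [y] occur at most three times in
    total, one of them, say [x], occurs only once.  If [y] also occurs only once,
    the lowest gate above both cannot produce [x /\ y] when [f] is false and
    [x \/ y] when [f] is true.  So [y] occurs twice, and climbing from the leaf
    [x] one meets a gate whose other input mentions a variable of [f]
    (otherwise some value of [y] would make [x] irrelevant); the right value of
    [x] forces that gate, and discards a fourth leaf. *)

Set Implicit Arguments.
Unset Strict Implicit.
Unset Printing Implicit Defensive.

(** * Formulas with constants and their restrictions *)

Section ConstFormula.

Variable T : eqType.

(* Constants are free of charge in [leaves], so that restricting a formula needs
   no simplification.  [Gate true] is a conjunction, [Gate false] a disjunction,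
   [Lit true] a negated variable. *)
Inductive cformula :=
| Const of bool
| Lit of bool & T
| Gate of bool & cformula & cformula.

Definition gate (a u v : bool) := if a then u && v else u || v.

Fixpoint ceval (F : cformula) (e : T -> bool) : bool :=
  match F with
  | Const b => b
  | Lit b i => b (+) e i
  | Gate a F1 F2 => gate a (ceval F1 e) (ceval F2 e)
  end.

Fixpoint leaves (p : pred T) (F : cformula) : nat :=
  match F with
  | Const _ => 0
  | Lit _ i => p i
  | Gate _ F1 F2 => leaves p F1 + leaves p F2
  end.

Fixpoint freeze (p : pred T) (r : T -> bool) (F : cformula) : cformula :=
  match F with
  | Const b => Const b
  | Lit b i => if p i then Const (b (+) r i) else Lit b i
  | Gate a F1 F2 => Gate a (freeze p r F1) (freeze p r F2)
  end.

Implicit Types (F G : cformula) (e : T -> bool) (p : pred T).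

Lemma gateC a u v : gate a u v = gate a v u.
Proof. by case: a u v => [] [] []. Qed.

Lemma gate_absorb a v : gate a (~~ a) v = ~~ a.
Proof. by case: a v => [] []. Qed.

Lemma gate_id a u : gate a u a = u.
Proof. by case: a u => [] []. Qed.

Lemma ceval_freeze p r F e :
  ceval (freeze p r F) e = ceval F (fun i => if p i then r i else e i).
Proof. by elim: F => //= [b i|a F1 -> F2 ->] //; case: ifP. Qed.

Lemma leaves_freeze p r F :
  leaves predT (freeze p r F) = leaves (predC p) F.
Proof. by elim: F => //= [b i|a F1 -> F2 ->] //; case: (p i). Qed.

Lemma leaves_predU p q F : (forall i, ~~ (p i && q i)) ->
  leaves (predU p q) F = leaves p F + leaves q F.
Proof.
move=> dis; elim: F => //= [b i|a F1 -> F2 ->]; last by rewrite addnACA.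
by have := dis i; case: (p i) (q i) => [] [].
Qed.

Lemma leaves_predC p F : leaves predT F = leaves p F + leaves (predC p) F.
Proof. by elim: F => //= [b i|a F1 -> F2 ->]; [case: (p i) | rewrite addnACA]. Qed.

Lemma eq_leaves p q F : p =1 q -> leaves p F = leaves q F.
Proof. by move=> epq; elim: F => //= [b i|a F1 -> F2 ->]; rewrite ?epq. Qed.

Lemma ceval_indep p F e e' : leaves p F = 0 ->
  (forall i, ~~ p i -> e i = e' i) -> ceval F e = ceval F e'.
Proof.
move=> + ee'; elim: F => //= [b i|a F1 IH1 F2 IH2].
  by case pi: (p i) => // _; rewrite ee' ?pi.
by move/eqP; rewrite addn_eq0 => /andP[/eqP/IH1-> /eqP/IH2->].
Qed.

(** * Occurrences of two distinguished variables *)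

Section TwoVariables.

Variables x y : T.
Hypothesis neq_xy : x != y.

Definition off_xy := predC (pred2 x y).

Lemma leaves_xy F :
  leaves predT F = leaves (pred1 x) F + leaves (pred1 y) F + leaves off_xy F.
Proof.
rewrite (leaves_predC (pred2 x y)); congr (_ + _).
rewrite -leaves_predU => [|i /=]; first exact: eq_leaves.
by case: eqP => // ->.
Qed.

Definition upd e (a b : bool) : T -> bool := [eta e with x |-> a, y |-> b].

Lemma upd_x e a b : upd e a b x = a.
Proof. by rewrite /upd /= eqxx. Qed.

Lemma upd_y e a b : upd e a b y = b.
Proof. by rewrite /upd /= eq_sym (negPf neq_xy) eqxx. Qed.

Lemma upd_off e a b i : off_xy i -> upd e a b i = e i.
Proof. by rewrite /off_xy /upd /= negb_or => /andP[/negPf-> /negPf->]. Qed.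

Lemma upd_neq_x e a a' b i : i != x -> upd e a b i = upd e a' b i.
Proof. by rewrite /upd /= => /negPf->. Qed.

Lemma upd_neq_y e a b b' i : i != y -> upd e a b i = upd e a b' i.
Proof. by rewrite /upd /= => /negPf->. Qed.

Lemma ceval_upd_x F e a a' b : leaves (pred1 x) F = 0 ->
  ceval F (upd e a b) = ceval F (upd e a' b).
Proof. by move=> F0; apply: ceval_indep F0 _ => i; apply: upd_neq_x. Qed.

Lemma ceval_upd_y F e a b b' : leaves (pred1 y) F = 0 ->
  ceval F (upd e a b) = ceval F (upd e a b').
Proof. by move=> F0; apply: ceval_indep F0 _ => i; apply: upd_neq_y. Qed.

Definition restrict (a b : bool) := freeze (pred2 x y) (upd xpredT a b).

Lemma ceval_restrict a b F e : ceval (restrict a b F) e = ceval F (upd e a b).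
Proof.
(* With [pred0], [ceval_indep] says that pointwise equal assignments give equal values. *)
rewrite ceval_freeze; apply: (@ceval_indep pred0) => [|i _ /=].
  by elim: F => //= _ F1 -> F2 ->.
by rewrite /upd /=; case: (i == x) => //=; case: (i == y).
Qed.

Definition restricts_to F e (g : bool -> bool -> bool) :=
  forall a b, ceval F (upd e a b) = g a b.

(* The gate where [x] and [y] meet decides which of the two is possible. *)
Lemma single_occurrences F e e' :
  leaves (pred1 x) F <= 1 -> leaves (pred1 y) F <= 1 ->
  restricts_to F e orb -> restricts_to F e' andb -> False.
Proof.
elim: F => [b|b i|a F1 IH1 F2 IH2].
- by move=> _ _ /(_ false false) /= -> /(_ true true).
- move=> _ _ or_e _; have := or_e false false.
  have [ix | nix] := eqVneq i x.
    by have := or_e false true; rewrite /= ix !upd_x => ->.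
  by have := or_e true false; rewrite /= (upd_neq_x e true false) // => ->.
(* Gates commute and [x] occurs at most once, so it may be assumed absent from [F2]. *)
wlog: F1 F2 IH1 IH2 / leaves (pred1 x) F2 = 0 => [wl|x2].
  move=> /= lex ley or_e and_e.
  have [x2|x2] := posnP (leaves (pred1 x) F2); first exact: wl or_e and_e.
  apply: (wl F2 F1 IH2 IH1); rewrite /=; try lia.
    by move=> b c; rewrite -or_e /= gateC.
  by move=> b c; rewrite -and_e /= gateC.
move=> /= lex ley or_e and_e.
have E2 d b c : ceval F2 (upd d b c) = ceval F2 (upd d true c).
  exact: ceval_upd_x.
have [y2|y2] := posnP (leaves (pred1 y) F2).
  (* Here [F2] ignores [x] and [y]; as the gate takes both values, [F2] has the neutral value
     [a]. *)
  have restrictF1 d g : restricts_to (Gate a F1 F2) d g ->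
      g false false = false -> g true true = true -> restricts_to F1 d g.
    move=> E g0 g1 b c.
    have E2a : ceval F2 (upd d true true) = a.
      move: (E false false) (E true true).
      rewrite /= g0 g1 (E2 d false false) (ceval_upd_y d true false true y2).
      by case: a (ceval F2 _) {E or_e and_e} => [] [] //=; rewrite ?andbF ?orbT.
    by rewrite -E /= E2 (ceval_upd_y d true c true y2) E2a gate_id.
  by apply: IH1 (restrictF1 _ _ or_e _ _) (restrictF1 _ _ and_e _ _) => //; lia.
have E1 d b c : ceval F1 (upd d b c) = ceval F1 (upd d b true).
  by apply: ceval_upd_y; lia.
(* Now [F1] ignores [y] and [F2] ignores [x]: their conjunction cannot be [orb], nor their
   disjunction [andb]. *)
case: a or_e and_e => [or_e _|_ and_e].
  move: (or_e false false) (or_e false true) (or_e true false).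
  rewrite /= !(E1 _ _ false) !(E2 _ false).
  by case: (ceval F1 _) => //=; case: (ceval F2 _) => //=; rewrite andbF.
move: (and_e true true) (and_e false true) (and_e true false).
rewrite /= !(E1 _ _ false) !(E2 _ false).
by case: (ceval F1 _) => //=; case: (ceval F2 _) => //=; rewrite orbT.
Qed.

Definition literal_x F := exists b, forall e, ceval F e = b (+) e x.

(** Leaves at [x] and [y] are not counted: both variables get fixed afterwards, [x] to [c]. *)
Definition sheds_leaf F := exists c G,
  (forall e, e x = c -> ceval G e = ceval F e) /\
  leaves off_xy G < leaves off_xy F.

Definition hides_x F := exists d, forall e a,
  ceval F (upd e a d) = ceval F (upd e (~~ a) d).

(** Going up from [x], the subformula stays a literal until the other input of a gate mentions a
    third variable ([sheds_leaf]) or absorbs for some value of [y] ([hides_x]). Higher gates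
    preserve both outcomes. *)
Lemma single_occurrence F : leaves (pred1 x) F = 1 ->
  [\/ literal_x F, sheds_leaf F | hides_x F].
Proof.
elim: F => [b|b i|a F1 IH1 F2 IH2] //=.
  by case: eqP => // -> _; constructor 1; exists b.
wlog: F1 F2 IH1 IH2 / leaves (pred1 x) F2 = 0 => [wl|x2] occ.
  have [x2|x2] := posnP (leaves (pred1 x) F2); first exact: wl.
  have [||[b E]|[c [G [E lt]]]|[d E]] := wl F2 F1 IH2 IH1; try lia.
  - by constructor 1; exists b => e; rewrite -E /= gateC.
  - constructor 2; exists c, G; split=> [e /E->|]; rewrite /= 1?gateC //.
    by move: lt; rewrite /= addnC.
  - by constructor 3; exists d => e b; move: (E e b); rewrite /= !(gateC a (ceval F2 _)).
have {IH1 IH2}[|[b E]|[c [G [E lt]]]|[d E]] := IH1; first by lia.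
- have [o2|o2] := posnP (leaves off_xy F2); last first.
    (* This value of [x] turns the literal into [~~ a], which absorbs [F2]. *)
    constructor 2; exists (b (+) ~~ a), (Const (~~ a)); split=> [e ex|] /=.
      by rewrite E ex addKb gate_absorb.
    by rewrite addn_gt0 o2 orbT.
  (* All leaves of [F2] are at [y]. *)
  have E2 e : ceval F2 e = ceval F2 (fun=> e y).
    apply: (@ceval_indep (predC (pred1 y))) => [|i /=]; last by rewrite negbK => /eqP->.
    by have := leaves_xy F2; rewrite (leaves_predC (pred1 y)); lia.
  have [[d gd]|g] : (exists d, ceval F2 (fun=> d) = ~~ a) \/
                    (forall d, ceval F2 (fun=> d) = a).
  + case: (boolP [exists d, ceval F2 (fun=> d) == ~~ a]).
      by move/existsP => [d /eqP]; left; exists d.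
    rewrite negb_exists => /forallP g; right=> d.
    by move: (g d); case: (ceval _ _) a {E g} => [] [].
  + constructor 3; exists d => e u.
    by rewrite /= !(E2 (upd _ _ _)) !upd_y gd !(gateC a _ (~~ a)) !gate_absorb.
  by constructor 1; exists b => e; rewrite /= E2 g gate_id E.
- constructor 2; exists c, (Gate a G F2); split=> [e /E /= -> //|/=].
  by rewrite ltn_add2r.
constructor 3; exists d => e u.
by rewrite /= E (ceval_upd_x _ _ (~~ u)).
Qed.

End TwoVariables.

(** * Removing one level of majority *)

Definition maj (a b c : bool) := a && (b || c) || b && c.

Lemma majC a b c : maj a b c = maj a c b.
Proof. by rewrite /maj orbC (andbC b) orbC (orbC b). Qed.

Definition indep_of x y (f : (T -> bool) -> bool) :=
  forall e e', (forall i, off_xy x y i -> e i = e' i) -> f e = f e'.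

(** A literal in [x] cannot respond to [y], and [hides_x] fails because the majority equals [x] when
    [y] and [f] are opposite; so a leaf is shed. *)
Lemma maj_elimination_single x y (f : (T -> bool) -> bool) F e0 e1 :
  x != y -> indep_of x y f -> f e0 = false -> f e1 = true ->
  (forall e, ceval F e = maj (f e) (e x) (e y)) ->
  leaves (pred1 x) F = 1 ->
  exists G, (forall e, ceval G e = f e) /\ leaves predT G + 4 <= leaves predT F.
Proof.
move=> neq_xy fI f0 f1 FE occ.
have FU e a b : ceval F (upd x y e a b) = maj (f e) a b.
  rewrite FE upd_x upd_y //; congr maj; apply: fI => i; exact: upd_off.
have [[b E]|[c [G [E lt]]]|[d E]] := single_occurrence neq_xy occ.
- have := FU e0 true false; have := FU e0 true true.
  by rewrite f0 !E !upd_x => ->.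
- exists (restrict x y c (~~ c) G); split=> [e|].
    by rewrite ceval_restrict E ?upd_x // FU; case: c (f e) {E} => [] [].
  rewrite leaves_freeze (leaves_xy neq_xy).
  (* One shed leaf, one leaf [x] and two leaves [y] make four. *)
  suff : 1 < leaves (pred1 y) F by move: lt; rewrite -/(off_xy x y); lia.
  rewrite ltnNge; apply/negP => ley.
  apply: (@single_occurrences x y neq_xy F e1 e0); rewrite ?occ // => a b.
    by rewrite FU f1; case: a b => [] [].
  by rewrite FU f0.
- by case: d E => E; [have := E e0 true | have := E e1 true];
    rewrite !FU ?f0 ?f1.
Qed.

Lemma maj_elimination x y (f : (T -> bool) -> bool) F e0 e1 :
  x != y -> indep_of x y f -> f e0 = false -> f e1 = true ->
  (forall e, ceval F e = maj (f e) (e x) (e y)) ->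
  exists G, (forall e, ceval G e = f e) /\ leaves predT G + 4 <= leaves predT F.
Proof.
move=> neq_xy fI f0 f1 FE.
have FU e a b : ceval F (upd x y e a b) = maj (f e) a b.
  rewrite FE upd_x upd_y //; congr maj; apply: fI => i; exact: upd_off.
have x0 : leaves (pred1 x) F != 0.
  apply/eqP => /(ceval_upd_x y e0 true false true).
  by rewrite !FU f0.
have y0 : leaves (pred1 y) F != 0.
  apply/eqP => /(ceval_upd_y x e0 true true false).
  by rewrite !FU f0.
have [x1|x1] := eqVneq (leaves (pred1 x) F) 1.
  exact: (maj_elimination_single neq_xy fI f0 f1 FE x1).
have [y1|y1] := eqVneq (leaves (pred1 y) F) 1.
  have neq_yx : y != x by rewrite eq_sym.
  apply: (maj_elimination_single neq_yx _ f0 f1 _ y1).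
    by move=> e e' ee'; apply: fI => i off; apply: ee'; rewrite /off_xy /= orbC.
  by move=> e; rewrite FE majC.
(* Both variables now occur at least twice, so fixing them discards four leaves. *)
exists (restrict x y true false F); split=> [e|].
  by rewrite ceval_restrict FU; case: (f e).
by rewrite leaves_freeze (leaves_xy neq_xy) -/(off_xy x y); lia.
Qed.

End ConstFormula.

(** * Lower bound, by induction from height 0, a single variable *)

Fixpoint urec (h : nat) (e : nat -> bool) : bool :=
  if h is k.+1 then maj (urec k e) (e k.*2.+1) (e k.*2.+2) else e 0.

Lemma eq_urec h e e' : (forall i, i <= h.*2 -> e i = e' i) -> urec h e = urec h e'.
Proof.
elim: h => [|h IH] ee' /=; first exact: ee'.
rewrite !ee' ?IH ?doubleS // => i lei.
by apply: ee'; lia.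
Qed.

Lemma urec_const h b : urec h (fun=> b) = b.
Proof. by elim: h => //= h ->; case: b. Qed.

Lemma urec_lower_bound h (F : cformula nat) :
  (forall e, ceval F e = urec h e) -> 4 * h + 1 <= leaves predT F.
Proof.
elim: h F => [|h IH] F FE.
  rewrite muln0 lt0n; apply/eqP => F0.
  (* Without leaves, [F] could not tell the two constant assignments apart. *)
  have := @ceval_indep _ predT F xpred0 xpredT F0.
  by rewrite !FE => /(_ (fun=> ltac:(by [])))/=.
(* [urec h] reads only indices up to [h.*2], so it is independent of the two new variables. *)
have [||G [/IH leG leF]] :=
  @maj_elimination _ h.*2.+1 h.*2.+2 _ F _ _ _ _
    (urec_const h false) (urec_const h true) FE.
- by lia.
- by move=> e e' ee'; apply: eq_urec => i lei; apply: ee'; rewrite /off_xy /=; lia.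
by apply: leq_trans leF; rewrite mulnSr addnAC leq_add2r.
Qed.

(** * Transfer to tuples and formulas without constants *)

Lemma MAJ3E (a b c : bool) (x : 3.-tuple bool) :
  tval x = [:: a; b; c] -> MAJ3 x = maj a b c.
Proof. by rewrite /MAJ3 => ->; case: a b c => [] [] []. Qed.

Lemma URecMAJ3E h (x : h.*2.+1.-tuple bool) : URecMAJ3 h x = urec h (nth false x).
Proof.
elim: h x => [x|[|h] IH x]; first by case: x => [[|a s]].
  by case: x => -[|a [|b [|c []]]] //= sz; rewrite (@MAJ3E a b c).
transitivity (maj (URecMAJ3 h.+1 [tuple nth false x i | i < h.+1.*2.+1])
                  (nth false x h.+1.*2.+1) (nth false x h.+1.*2.+2)).
  exact: MAJ3E.
rewrite IH.
congr maj; apply: (@eq_urec h.+1) => i lei.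
have lti : i < h.+1.*2.+1 by lia.
by rewrite -(tnth_nth false _ (Ordinal lti)) tnth_mktuple.
Qed.

Fixpoint of_formula n (F : formula n) : cformula nat :=
  match F with
  | Var i => Lit false (i : nat)
  | NegVar i => Lit true (i : nat)
  | And F1 F2 => Gate true (of_formula F1) (of_formula F2)
  | Or F1 F2 => Gate false (of_formula F1) (of_formula F2)
  end.

Lemma leaves_of_formula n (F : formula n) : leaves predT (of_formula F) = fsize F.
Proof. by elim: F => //= F1 -> F2 ->. Qed.

Lemma ceval_of_formula n (F : formula n) e :
  ceval (of_formula F) e = feval F [tuple e i | i < n].
Proof.
by elim: F => [i|i|F1 IH1 F2 IH2|F1 IH1 F2 IH2] /=;
  rewrite ?tnth_mktuple ?IH1 ?IH2.
Qed.

Lemma URecMAJ3_lower_bound h (F : formula h.*2.+1) :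
  computes F (URecMAJ3 h) -> 4 * h + 1 <= fsize F.
Proof.
move=> FE; rewrite -leaves_of_formula; apply: urec_lower_bound => e.
rewrite ceval_of_formula FE URecMAJ3E; apply: eq_urec => i lei.
have lti : i < h.*2.+1 by [].
by rewrite -(tnth_nth false _ (Ordinal lti)) tnth_mktuple.
Qed.

(** * A monotone formula attaining the bound *)

Fixpoint urec_formula n (v : nat -> 'I_n) (h : nat) : formula n :=
  if h is k.+1 then
    let x := Var (v k.*2.+1) in let y := Var (v k.*2.+2) in
    Or (And (urec_formula v k) (Or x y)) (And x y)
  else Var (v 0).

Lemma feval_urec_formula n (v : nat -> 'I_n) h x :
  feval (urec_formula v h) x = urec h (fun i => tnth x (v i)).
Proof. by elim: h => //= h ->. Qed.

Lemma fsize_urec_formula n (v : nat -> 'I_n) h :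
  fsize (urec_formula v h) = 4 * h + 1.
Proof. by elim: h => //= h ->; lia. Qed.

Lemma monotone_urec_formula n (v : nat -> 'I_n) h : monotone (urec_formula v h).
Proof. by elim: h => //= h ->. Qed.

(** [inord] is faithful on indices up to [h.*2], the only ones that [urec h] reads. *)
Lemma urec_formula_computes h :
  computes (urec_formula (@inord h.*2) h) (URecMAJ3 h).
Proof.
move=> x; rewrite feval_urec_formula URecMAJ3E; apply: eq_urec => i lei.
by rewrite (tnth_nth false) inordK.
Qed.

Theorem theorem5p1 (h : nat) (h_ge1 : 1 <= h) :
  L_eq (URecMAJ3 h) (4 * h + 1) /\ Lm_eq (URecMAJ3 h) (4 * h + 1).
Proof.
have FE := @urec_formula_computes h.
split; split.
- by exists (urec_formula (@inord h.*2) h); rewrite fsize_urec_formula.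
- by move=> k [F [/URecMAJ3_lower_bound leF <-]].
- exists (urec_formula (@inord h.*2) h).
  by rewrite fsize_urec_formula monotone_urec_formula.
by move=> k [F [_ /URecMAJ3_lower_bound leF <-]].
Qed.
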